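(* Let $\mathbb{F}$ be a field with $4$ elements, endowed with its non-identity involution $x\mapsto x^\star$. Then the range-compatible homomorphisms on $\mathcal{H}_2(\mathbb{F})$ are exactly the sums of the local maps and of the scalar multiples (by elements of $\mathbb{F}$) of the mapping $$\begin{bmatrix} a & x^\star \\ x & b \end{bmatrix} \in \mathcal{H}_2(\mathbb{F}) \longmapsto \begin{bmatrix} x \\ x^\star \end{bmatrix} \in \mathbb{F}^2.$$
   Context: The non-identity involution of the field $\mathbb{F}$ with $4$ elements is its non-identity automorphism $x\mapsto x^\star=x^2$. $\mathcal{H}_2(\mathbb{F})$ denotes the additive group of all $2$-by-$2$ matrices $M=(m_{i,j})$ over $\mathbb{F}$ such that $m_{j,i}^\star=m_{i,j}$ for all $i,j$, i.e. the matrices $\begin{bmatrix} a & x^\star \\ x & b\end{bmatrix}$ with $x\in\mathbb{F}$ and $a,b$ fixed by $(-)^\star$. The range of a matrix is the linear span of its columns in $\mathbb{F}^2$. A range-compatible homomorphism on $\mathcal{H}_2(\mathbb{F})$ is a group homomorphism $F:(\mathcal{H}_2(\mathbb{F}),+)\to(\mathbb{F}^2,+)$ such that $F(M)$ belongs to the range of $M$ for all $M$. A map $F:\mathcal{H}_2(\mathbb{F})\to\mathbb{F}^2$ is local if there exists $X\in\mathbb{F}^2$ such that $F(M)=MX$ for all $M$. *)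

(* Defs.v *)
From HB Require Import structures.
From mathcomp Require Import all_boot all_order all_algebra.

Set Implicit Arguments.
Unset Strict Implicit.
Unset Printing Implicit Defensive.

Import GRing.Theory.
Local Open Scope ring_scope.

Section Hermitian.

Variables (F : fieldType) (star : {rmorphism F -> F}) (n : nat).

Definition hermitian_mx : {pred 'M[F]_n} :=
  fun M => [forall i, forall j, star (M j i) == M i j].

Lemma hermitian_mxP (M : 'M[F]_n) :
  reflect (forall i j, star (M j i) = M i j) (M \in hermitian_mx).
Proof. exact: 'forall_'forall_eqP. Qed.

Fact hermitian_mx_zmod_closed : zmod_closed hermitian_mx.
Proof.
split=> [|M N /hermitian_mxP hM /hermitian_mxP hN]; apply/hermitian_mxP=> i j.
  by rewrite !mxE rmorph0.
by rewrite !mxE rmorphB /= hM hN.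
Qed.

HB.instance Definition _ :=
  GRing.isZmodClosed.Build 'M[F]_n hermitian_mx hermitian_mx_zmod_closed.

Record herm := Herm { herm_mx :> 'M[F]_n; _ : herm_mx \in hermitian_mx }.

HB.instance Definition _ := [isSub for herm_mx].
HB.instance Definition _ := [Choice of herm by <:].
HB.instance Definition _ := [SubChoice_isSubZmodule of herm by <:].

(* Mathcomp's %MS relation compares row spaces; transposing turns it into
   membership of a column vector in the column space. *)
Definition range_compatible (f : herm -> 'cV[F]_n) : Prop :=
  forall M : herm, ((f M)^T <= (herm_mx M)^T)%MS.

Definition local_map (f : herm -> 'cV[F]_n) : Prop :=
  exists X : 'cV[F]_n, forall M : herm, f M = herm_mx M *m X.

End Hermitian.

(* Rows and columns are indexed from 0, so x is the entry M 1 0. *)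
Definition offdiag_map (F : fieldType) (star : {rmorphism F -> F})
    (M : herm star 2) : 'cV[F]_2 :=
  let x := herm_mx M 1 0 in \col_i (if i == 0 then x else star x).

(* Main.v *)
(* Additivity and the matrices diag(1, 0), diag(0, 1) fix the diagonal part of
   [f], which is that of a local map. Once this part is removed, [f] sends
   [[1, x^*], [x, 1]] to some (p x, q x), and as this matrix has rank 1 for
   [x != 0], range compatibility reads [q x = x * p x]. Polarizing this identity
   between additive maps gives [x * p y = y * p x] in characteristic 2, so
   [p x = p 1 * x] and [q x = p 1 * x ^+ 2 = p 1 * x^*]. *)
From HB Require Import structures.
Require Import Defs.
From mathcomp Require Import all_boot all_order all_algebra all_field.
From mathcomp Require Import ring.

Import GRing.Theory.
Local Open Scope ring_scope.

Lemma pchar2_card4 (F : finFieldType) : #|F| = 4%N -> 2%N \in [pchar F].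
Proof. by move=> hF; apply: (@card_finPcharP F 2 2). Qed.

(** An element [w] moved by [star] differs from 0 and 1, so [0, 1, w, star w] exhaust the field. Now
    [w ^+ 2] cannot be 0 or [w], and if it were 1 then [w = w ^+ 4 = 1]; hence it is [star w]. The
    value at [star w] then follows from [w ^+ 4 = w]. *)
Lemma involution_card4 {F : finFieldType} (star : {rmorphism F -> F}) :
  #|F| = 4%N -> involutive star -> ~ (star =1 id) ->
  forall x, star x = x ^+ 2.
Proof.
move=> hF starK star_nid.
have [w w_nfix] : exists w, star w != w.
  apply/existsP; apply: contra_notT star_nid => /existsPn star_id x.
  by apply/eqP; rewrite -[_ == _]negbK star_id.
have w0 : w != 0 by apply: contraNneq w_nfix => ->; rewrite rmorph0.
have w1 : w != 1 by apply: contraNneq w_nfix => ->; rewrite rmorph1.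
have elems_uniq : uniq [:: 0; 1; w; star w].
  rewrite /= !inE !negb_or !(eq_sym _ w) !(eq_sym _ (star w)) (eq_sym 0).
  by rewrite fmorph_eq0 fmorph_eq1 oner_eq0 w0 w1 w_nfix.
have elemsP x : x \in [:: 0; 1; w; star w].
  have /subset_cardP/(_ (subset_predT _))-> // : #|[:: 0; 1; w; star w]| = #|F|.
  by rewrite hF; apply/card_uniqP.
have w4 : w ^+ 4 = w by rewrite -hF expf_card.
have star_w : star w = w ^+ 2.
  have := elemsP (w ^+ 2); rewrite !inE expf_eq0 (negPf w0) /=.
  case/or3P=> /eqP // w2.
    by move: w1; rewrite -w4 (exprM w 2 2) w2 expr1n eqxx.
  by move: w1; rewrite -(inj_eq (mulfI w0)) mulr1 -expr2 w2 eqxx.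
move=> x; have := elemsP x; rewrite !inE => /or4P[] /eqP ->.
- by rewrite rmorph0 expr0n.
- by rewrite rmorph1 expr1n.
- exact: star_w.
- by rewrite starK star_w -exprM w4.
Qed.

Lemma range_compatibleP (F : fieldType) (star : {rmorphism F -> F}) n
    (f : herm star n -> 'cV[F]_n) :
  range_compatible f <-> forall M, exists v, f M = herm_mx M *m v.
Proof.
split=> [fR M | fR M].
  have /submxP[D defD] := fR M; exists D^T.
  by apply: trmx_inj; rewrite defD trmx_mul trmxK.
by have [v ->] := fR M; rewrite trmx_mul submxMl.
Qed.

Lemma mulmx2E (R : pzRingType) (A : 'M[R]_2) (v : 'cV[R]_2) i :
  (A *m v) i 0 = A i 0 * v 0 0 + A i 1 * v 1 0.
Proof.
rewrite mxE !big_ord_recl big_ord0 addr0.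
by rewrite (_ : lift ord0 ord0 = 1) //; apply: val_inj.
Qed.

Lemma ord2P (P : 'I_2 -> Prop) : P 0 -> P 1 -> forall i, P i.
Proof.
move=> P0 P1 [[|[|//]] lt_i].
  by rewrite (_ : Ordinal lt_i = 0) //; apply: val_inj.
by rewrite (_ : Ordinal lt_i = 1) //; apply: val_inj.
Qed.

Lemma cV2P (R : Type) (u v : 'cV[R]_2) :
  u 0 0 = v 0 0 -> u 1 0 = v 1 0 -> u = v.
Proof. by move=> e0 e1; apply/colP; apply: ord2P. Qed.

Lemma herm2P {F : fieldType} (star : {rmorphism F -> F}) (M N : herm star 2) :
  M 0 0 = N 0 0 -> M 1 0 = N 1 0 -> M 1 1 = N 1 1 -> M = N.
Proof.
move=> e00 e10 e11; apply: val_inj; apply/matrixP.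
have hM := hermitian_mxP star _ (valP M).
have hN := hermitian_mxP star _ (valP N).
by apply: ord2P; apply: ord2P => //; rewrite /= -hM -hN e10.
Qed.

Lemma idem_natr_bool (R : idomainType) (a : R) :
  a ^+ 2 = a -> exists b : bool, a = b%:R.
Proof.
move/eqP; rewrite expr2 -[X in _ == X]mulr1 -subr_eq0 -mulrBr mulf_eq0 subr_eq0.
by case/orP=> /eqP->; [exists false | exists true].
Qed.

(** Booleans suffice for the diagonal: its entries are fixed by squaring, hence are 0 or 1. The
    default 0 of [insubd] is never reached when [star] is involutive. *)
Definition herm2 {F : fieldType} (star : {rmorphism F -> F}) (a b : bool)
    (x : F) : herm star 2 :=
  insubd 0 (\matrix_(i, j) if i == j then (if i == 0 then a else b)%:R
                           else if i == 0 then star x else x).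

Lemma herm2_mxE {F : fieldType} (star : {rmorphism F -> F}) a b x :
  involutive star ->
  [/\ herm2 star a b x 0 0 = a%:R, herm2 star a b x 0 1 = star x,
      herm2 star a b x 1 0 = x & herm2 star a b x 1 1 = b%:R].
Proof.
move=> starK.
rewrite /herm2 -[herm_mx _]/(val _) val_insubd ifT; first by split; rewrite mxE.
by apply/hermitian_mxP; apply: ord2P; apply: ord2P; rewrite !mxE //= rmorph_nat.
Qed.

Lemma herm2D {F : fieldType} (star : {rmorphism F -> F}) a b x y :
  involutive star ->
  herm2 star a b (x + y) = herm2 star a b x + herm2 star false false y.
Proof.
move=> starK.
have [e00 _ e10 e11] := herm2_mxE star a b (x + y) starK.
have [x00 _ x10 x11] := herm2_mxE star a b x starK.
have [y00 _ y10 y11] := herm2_mxE star false false y starK.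
by apply: herm2P; rewrite /= mxE ?(e00, e10, e11) ?(x00, x10, x11)
  ?(y00, y10, y11) ?addr0.
Qed.

(** The booleans act as multiplicities 0 or 1, so any additive map, linear or not, can be pushed
    through this decomposition. *)
Lemma herm2_split {F : fieldType} (star : {rmorphism F -> F}) a b x :
  involutive star ->
  herm2 star a b x = herm2 star true false 0 *+ a + herm2 star false true 0 *+ b
                     + herm2 star false false x.
Proof.
move=> starK.
rewrite -[x in LHS]add0r herm2D //; congr (_ + _).
have [a00 _ a10 a11] := herm2_mxE star true false 0 starK.
have [b00 _ b10 b11] := herm2_mxE star false true 0 starK.
have [e00 _ e10 e11] := herm2_mxE star a b 0 starK.
by apply: herm2P; rewrite ?(e00, e10, e11); case: a {e00 e10 e11};
  case: b; rewrite /= !mxE ?(a00, a10, a11) ?(b00, b10, b11) ?addr0 ?add0r.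
Qed.

Lemma herm2_ex {F : fieldType} (star : {rmorphism F -> F}) (M : herm star 2) :
  involutive star -> (forall x, star x = x ^+ 2) ->
  exists a b x, M = herm2 star a b x.
Proof.
move=> starK star_sqr; have hM := hermitian_mxP star _ (valP M).
have diagP i : exists b : bool, herm_mx M i i = b%:R.
  by apply: idem_natr_bool; rewrite -star_sqr hM.
have [a Ma] := diagP 0; have [b Mb] := diagP 1; exists a, b, (herm_mx M 1 0).
have [e00 _ e10 e11] := herm2_mxE star a b (herm_mx M 1 0) starK.
by apply: herm2P; rewrite ?e00 ?e10 ?e11.
Qed.

(** Polarization at the pair [x, 1] is enough: expanding [q (x + 1)] in two ways leaves
    [x * p 1 + p x = 0], and signs vanish in characteristic 2. *)
Lemma additive_scalarP {F : fieldType} (p q : {additive F -> F}) :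
  2%N \in [pchar F] -> (forall x, q x = x * p x) -> forall x, p x = p 1 * x.
Proof.
move=> F2 qE x; have := qE (x + 1).
rewrite !raddfD !qE /= mul1r mulrDl !mulrDr !mul1r -!addrA => /addrI.
rewrite addrA -[LHS]add0r => /addIr/esym/eqP.
by rewrite addr_eq0 oppr_pchar2 // mulrC => /eqP.
Qed.

Theorem theorem1p6 (F : finFieldType) (hF : #|F| = 4%N)
    (star : {rmorphism F -> F})
    (star_inv : involutive star) (star_nid : ~ (star =1 id))
    (f : herm star 2 -> 'cV[F]_2) :
  (zmod_morphism f /\ range_compatible f) <->
  (exists g : herm star 2 -> 'cV[F]_2, local_map g /\
   exists c : F, forall M : herm star 2, f M = g M + c *: offdiag_map M).
Proof.
have star_sqr := involution_card4 star hF star_inv star_nid.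
have F2 := pchar2_card4 F hF.
have x4 (x : F) : x ^+ 4 = x by rewrite -hF expf_card.
split=> [[fB /range_compatibleP fR] | [g [[X gE] [c fE]]]]; last first.
  split=> [M N|].
    rewrite !fE !gE; apply: cV2P; rewrite !(mulmx2E, mxE) /= ?rmorphB /=; ring.
  apply/range_compatibleP=> M.
  suff [v ME] : exists v, offdiag_map M = herm_mx M *m v.
    by exists (X + c *: v); rewrite fE gE mulmxDr -scalemxAr ME.
  have [a [b [x ->]]] := herm2_ex star M star_inv star_sqr.
  have [e00 e01 e10 e11] := herm2_mxE star a b x star_inv.
  (* If [a] is 1, then [x] times the first column is already [(x, x ^+ 2)]. If [a] is 0, the
     coefficient [x ^+ 2] of the second column yields [x ^+ 4 = x] in the first row and [b * x ^+ 2]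
     in the second, where the first column supplies the missing [(1 - b) * x ^+ 2]. *)
  exists (\col_i if i == 0 then (if a then x else (1 - b%:R) * x)
                 else if a then 0 else x ^+ 2).
  apply: cV2P; rewrite mulmx2E !mxE /= ?e00 ?e01 ?e10 ?e11 star_sqr.
    case: a {e00 e01 e10 e11} => /=; first by ring.
    by rewrite -{1}(x4 x); ring.
  by case: a {e00 e01 e10 e11}; rewrite /=; ring.
pose fM : {additive herm star 2 -> 'cV[F]_2} :=
  HB.pack f (GRing.isZmodMorphism.Build _ _ f fB).
pose K := herm2 star false false.
pose E1 := herm2 star true false 0; pose E2 := herm2 star false true 0.
(* The local map of a vector [X] sends [E1] to [(X 0 0, 0)] and [E2] to [(0, X 1 0)], which forces
   [X = (alpha, beta)]. *)
pose alpha := f E1 0 0; pose beta := f E2 1 0.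
have f_split a b x : f (herm2 star a b x) = f E1 *+ a + f E2 *+ b + f (K x).
  by rewrite -![f _]/(fM _) herm2_split // !raddfD !raddfMn.
have fE1 : f E1 1 0 = 0.
  have [v ->] := fR E1.
  have [_ _ e10 e11] := herm2_mxE star true false 0 star_inv.
  by rewrite mulmx2E e10 e11 !mul0r addr0.
have fE2 : f E2 0 0 = 0.
  have [v ->] := fR E2.
  have [e00 e01 _ _] := herm2_mxE star false true 0 star_inv.
  by rewrite mulmx2E e00 e01 (rmorph0 star) !mul0r addr0.
have fKB x y : f (K (x - y)) = f (K x) - f (K y).
  apply/eqP; rewrite eq_sym subr_eq -![f _]/(fM _) -raddfD /K -herm2D //.
  by rewrite subrK.
(* Since [K x] maps [(alpha, beta)] to [(star x * beta, x * alpha)], [p] and [q] are the coordinates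
   of [f] minus its local part on the matrices of zero diagonal. *)
pose p x := f (K x) 0 0 - star x * beta.
pose q x := f (K x) 1 0 - x * alpha.
have pB : zmod_morphism p.
  by move=> x y; rewrite /p fKB rmorphB !mxE; ring.
have qB : zmod_morphism q.
  by move=> x y; rewrite /q fKB !mxE; ring.
pose pM : {additive F -> F} := HB.pack p (GRing.isZmodMorphism.Build _ _ p pB).
pose qM : {additive F -> F} := HB.pack q (GRing.isZmodMorphism.Build _ _ q qB).
have pqE x : qM x = x * pM x.
  have [-> | x0] := eqVneq x 0; first by rewrite raddf0 mul0r.
  (* This is [x * star x = 1]: the second row [(x, 1)] of [herm2 star true true x] is [x] times its
     first row [(1, x ^+ 2)]. *)
  have x3 : x ^+ 3 = 1 by apply: (mulfI x0); rewrite -exprS x4 mulr1.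
  have [v] := fR (herm2 star true true x).
  have [e00 e01 e10 e11] := herm2_mxE star true true x star_inv.
  rewrite f_split => /matrixP fv; have := fv 0 0; have := fv 1 0.
  rewrite !mulmx2E e00 e01 e10 e11 !mxE fE1 fE2 -/alpha -/beta.
  rewrite star_sqr addr0 add0r !mul1r.
  move=> /(canRL (addKr _)) q_v /(canRL (addKr _)) p_v.
  rewrite /= /p /q star_sqr q_v p_v.
  (* On the left [v 1 0] and [beta] have coefficients 1 and -1, on the right [x ^+ 3] and
     [- x ^+ 3]; writing 1 as [x ^+ 3] makes both sides the same polynomial. *)
  by rewrite -[v 1 0 in LHS]mul1r -[beta in LHS]mul1r -x3; ring.
have pE x : p x = p 1 * x := additive_scalarP pM qM F2 pqE x.
exists (fun M => herm_mx M *m \col_i if i == 0 then alpha else beta).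
split; first by eexists.
exists (p 1) => M; have [a [b [x ->]]] := herm2_ex star M star_inv star_sqr.
have [e00 e01 e10 e11] := herm2_mxE star a b x star_inv.
have qE : q x = p 1 * x ^+ 2 by have /= -> := pqE x; rewrite pE; ring.
rewrite f_split; apply: cV2P; rewrite [RHS]mxE mulmx2E !mxE
  !mulmxnE ?(e00, e01, e10, e11) star_sqr /=.
  by rewrite fE2 mul0rn addr0 mulr_natl -pE /p star_sqr -addrA subrKC.
by rewrite fE1 mul0rn add0r mulr_natl -qE /q [x * _ + _]addrC -addrA subrKC.
Qed.
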